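(* Let $k>2$, $sc_k=(k,k-1,\ldots,1)$, $S\in SYT(sc_k)$ and $n=k(k+1)/2$. Then dual-evacuation $\epsilon^*$ rotates $\mathrm{Des}_e(S)$ to the right by $n+1$ positions and then flips the result of the rotation. More precisely, the $i$-th box of $\mathrm{Des}_e(\epsilon^*(S))$ is dotted if and only if the $(n-i)$-th (mod $2n$) box of $\mathrm{Des}_e(S)$ is dotted.
   Context: Tableaux are in English notation; box $(i,j)$ is in row $i$ from the top and column $j$ from the left, and $T[i,j]$ is the entry of $T$ in that box. $SYT(\lambda)$ is the set of standard Young tableaux of shape $\lambda$. Promotion: for $T\in SYT(\lambda)$ with $|\lambda|=m$, remove the entry $m$ from its box, leaving it empty. Repeatedly move into the empty box the larger of the entries directly north and directly west of it (or the only one present), so the empty box moves to the position of that entry, until the empty box reaches $(1,1)$. Then put $0$ in the empty box and add $1$ to every entry. The result is $\partial(T)\in SYT(\lambda)$. Dual-evacuation: for $T\in SYT(\lambda)$ with $|\lambda|=m$, put $T_0=T$, $\lambda_0=\lambda$. For $k=0,1,\ldots,m-1$: in $T_k$ (a filling of the partition shape $\lambda_k$) remove the smallest entry, which is in box $(1,1)$, and repeatedly move into the empty box the smaller of the entries directly south and directly east of it (or the only one present), so the empty box moves to the position of that entry, until no box of $\lambda_k$ lies directly south or east of it; let $(i_k,j_k)$ be its final position. Set $\epsilon^*(T)[i_k,j_k]=m-k$. Delete box $(i_k,j_k)$ to obtain $\lambda_{k+1}$ and $T_{k+1}$. This defines $\epsilon^*(T)\in SYT(\lambda)$. Descents: $i$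 is a descent of $T$ if $i+1$ appears in a row strictly south of (below) the row of $i$; $\mathrm{Des}(T)$ is the set of descents. Descent vector of a staircase tableau: for $S\in SYT(sc_k)$, $\mathrm{Des}_e(S)$ is an array of $2n$ boxes. For $1\le i\le n-1$: if $i\in\mathrm{Des}(S)$ the $i$-th box is dotted and the $(n+i)$-th is empty; otherwise the $(n+i)$-th box is dotted and the $i$-th is empty. If $1\in\mathrm{Des}(\partial(S))$ the $n$-th box is empty and the $2n$-th is dotted; otherwise the $n$-th box is dotted and the $2n$-th is empty. The array is regarded as circular (indices mod $2n$). Rotating to the right by $d$ positions sends the content of box $i$ to box $i+d$ (mod $2n$); flipping sends the content of box $i$ to box $2n+1-i$. *)

(* Defs.v *)
From HB Require Import structures.
From mathcomp Require Import all_boot all_order all_algebra.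

Set Implicit Arguments.
Unset Strict Implicit.
Unset Printing Implicit Defensive.

(* Boxes are 0-based: the box written (i, j) in the literature (row i from the
   top, column j from the left, both starting at 1) is (i.-1, j.-1) here. *)
Definition box : Type := (nat * nat)%type.

Definition diagram (la : seq nat) : seq box :=
  [seq (i, j) | i <- iota 0 (size la), j <- iota 0 (nth 0 la i)].

(* A filling is a total function; only its values on the boxes of the shape
   under consideration are meaningful. *)
Definition filling : Type := box -> nat.

(* Entries vanish outside the diagram, so that a standard Young tableau of a
   given shape has a single representation. *)
Definition SYT (la : seq nat) (T : filling) : Prop :=
  [/\ forall b, b \notin diagram la -> T b = 0,
      forall b, b \in diagram la -> 1 <= T b <= sumn la,
      {in diagram la &, injective T},
      forall i j, (i, j.+1) \in diagram la -> T (i, j) < T (i, j.+1)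
    & forall i j, (i.+1, j) \in diagram la -> T (i, j) < T (i.+1, j)].

Definition upd (T : filling) (b : box) (v : nat) : filling :=
  fun c => if c == b then v else T c.

Definition box_of (D : seq box) (T : filling) (v : nat) : box :=
  nth (0, 0) D (find (fun b => T b == v) D).

(* A sliding state is a filling together with the position of its empty box;
   the value that the filling keeps at the empty box is never read. *)
Definition slide_from (T : filling) (hole b : box) : filling * box :=
  (upd T hole (T b), b).

Definition slide_nw (s : filling * box) : filling * box :=
  let T := s.1 in
  match s.2 with
  | (0, 0) => s
  | (0, j.+1) => slide_from T s.2 (0, j)
  | (i.+1, 0) => slide_from T s.2 (i, 0)
  | (i.+1, j.+1) =>
      if T (i.+1, j) < T (i, j.+1) then slide_from T s.2 (i, j.+1)
      else slide_from T s.2 (i.+1, j)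
  end.

(* The empty box reaches (0, 0) from b in exactly b.1 + b.2 slides. *)
Definition promotion (la : seq nat) (T : filling) : filling :=
  let D := diagram la in
  let b := box_of D T (sumn la) in
  let s := iter (b.1 + b.2) slide_nw (T, b) in
  let T' := upd s.1 s.2 0 in
  fun c => if c \in D then (T' c).+1 else 0.

Definition slide_se (D : seq box) (s : filling * box) : filling * box :=
  let T := s.1 in
  let south := (s.2.1.+1, s.2.2) in
  let east := (s.2.1, s.2.2.+1) in
  match south \in D, east \in D with
  | true, true =>
      if T south < T east then slide_from T s.2 south
      else slide_from T s.2 east
  | true, false => slide_from T s.2 south
  | false, true => slide_from T s.2 east
  | false, false => s
  end.

(* D is the current shape, T the current filling, m the number of boxes of D
   and E the part of the result that is already known.  No sliding path in D
   has more than size D slides, and slide_se is the identity afterwards. *)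
Fixpoint dual_evac_rec (m : nat) (D : seq box) (T E : filling) : filling :=
  if m is m'.+1 then
    let s := iter (size D) (slide_se D) (T, (0, 0)) in
    dual_evac_rec m' (rem s.2 D) s.1 (upd E s.2 m)
  else E.

Definition dual_evac (la : seq nat) (T : filling) : filling :=
  dual_evac_rec (sumn la) (diagram la) T (fun=> 0).

Definition Des (la : seq nat) (T : filling) (i : nat) : bool :=
  has (fun b => has (fun c => [&& T b == i, T c == i.+1 & b.1 < c.1])
                    (diagram la))
      (diagram la).

Definition staircase (k : nat) : seq nat := rev (iota 1 k).

(* true means dotted and false means empty; boxes are numbered from 1, so the
   i-th box is at index i.-1 of the sequence.  On such sequences, rotr d is the
   rotation to the right by d positions (for d at most the size), and rev is
   the flip. *)
Definition Des_e (k : nat) (S : filling) : seq bool :=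
  let la := staircase k in
  let n := (k * k.+1)./2 in
  let dotted i :=
    if i < n then Des la S i
    else if i == n then ~~ Des la (promotion la S) 1
    else if i < 2 * n then ~~ Des la S (i - n)
    else Des la (promotion la S) 1 in
  [seq dotted i | i <- iota 1 (2 * n)].

(* The i-th box of a nonempty circular array, i being read modulo its size. *)
Definition circ_box (s : seq bool) (i : int) : bool :=
  nth false s (absz ((i - 1)%R %% Posz (size s))%Z).

(* Main.v *)
Require Import Defs.
From HB Require Import structures.
From mathcomp Require Import all_boot all_order all_algebra.
From mathcomp Require Import zify.

Set Implicit Arguments.
Unset Strict Implicit.
Unset Printing Implicit Defensive.

(** A standard tableau of size n is recorded as the word w of its boxes, w_i
    being the box of the entry i + 1; such a word is a linear extension of the
    shape.  The toggle t_i exchanges w_i and w_(i+1) unless the two boxes are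
    adjacent.  A jeu de taquin slide scans the entries in order and lets the
    empty box change places with the first adjacent box that it meets, so, with
    m = n - 1, promotion is t_(m-1), ..., t_0 (in the order of application) and
    the first slide of dual evacuation is t_0, ..., t_(m-1).  Dual evacuation
    as a whole is t_0, ..., t_(m-1), then t_0, ..., t_(m-2), and so on down to
    t_0 alone.

    The main geometric input on descents is [desc_toggle_pair]: applying t_i and
    then t_(i+1) moves a descent at i + 1 to i.  Besides, t_0 acts trivially,
    and distant toggles commute and do not disturb a descent.

    - Regrouping t_0 ... t_(M-1) t_0 ... t_(M-2) as t_0 (t_1 t_0) (t_2 t_1) ...
      carries the first descent to the last place.  This gives the classical
      fact that dual evacuation reverses the descent set ([desc_evac]).

    - The same regrouping, read backwards, shows that 1 is a descent of the
      promotion of w exactly when t_0 ... t_(m-2) turns w into a word with a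
      descent at its last two boxes ([desc_promotion]).  Dual evacuation can
      also be written as the dual evacuation of the first n - 1 boxes followed
      by t_(m-1), ..., t_0 ([run_evac_toggles]).  Comparing the two, the words
      that govern the promotions of S and of its dual evacuation differ, at the
      last two boxes, by t_(m-1) only.  In a staircase the last two boxes of a
      linear extension are never adjacent, so t_(m-1) exchanges them and swaps
      descent and ascent ([desc_promotion_evac]).  This is where the
      shape matters.

    These two facts are exactly the claimed symmetry of the circular array. *)

(** * Boxes and linear extensions *)

Definition covers (x y : box) : bool :=
  (y == (x.1.+1, x.2)) || (y == (x.1, x.2.+1)).

(** [s] lists the boxes of a skew shape in an order in which they can be added
    to the shape with set of boxes [p].  Only the set underlying [p] matters; it
    is carried along so that inductions can go under the head of [s]. *)
Fixpoint linext (p s : seq box) : Prop :=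
  if s is y :: s' then
    [/\ y \notin p, forall x, covers x y -> x \in p & linext (y :: p) s']
  else True.

Definition ideal (p : seq box) : Prop :=
  forall x y, covers x y -> y \in p -> x \in p.

(** The Bender-Knuth involution exchanging the entries i + 1 and i + 2 whenever
    the result is still standard. *)
Fixpoint toggle (i : nat) (w : seq box) : seq box :=
  match i, w with
  | 0, x :: y :: s => if covers x y then w else y :: x :: s
  | i'.+1, x :: s => x :: toggle i' s
  | _, _ => w
  end.

(** The toggles are applied from left to right. *)
Definition run (ts : seq nat) (w : seq box) : seq box :=
  foldl (fun v i => toggle i v) w ts.

(** On the word of a tableau, this says that i + 1 is a descent. *)
Definition desc (i : nat) (w : seq box) : bool :=
  (nth (0, 0) w i).1 < (nth (0, 0) w i.+1).1.

(** Dual evacuation of a word of m + 1 boxes: each pass brings the end of one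
    sliding path to its final place, and the next pass stops one step earlier. *)
Fixpoint evac_toggles (m : nat) : seq nat :=
  if m is m'.+1 then iota 0 m ++ evac_toggles m' else [::].

Lemma coversP x y :
  reflect (y = (x.1.+1, x.2) \/ y = (x.1, x.2.+1)) (covers x y).
Proof. by apply: (iffP orP) => -[/eqP|/eqP]; auto. Qed.

Lemma ideal_nil : ideal [::]. Proof. by []. Qed.

Lemma ideal_cons p y :
  ideal p -> (forall x, covers x y -> x \in p) -> ideal (y :: p).
Proof.
move=> dp yp a b cab; rewrite !inE => /orP[/eqP eb|bp].
  by rewrite yp ?orbT // -eb.
by rewrite (dp _ _ cab bp) orbT.
Qed.

Lemma ideal_row p i a b : ideal p -> (i, b) \in p -> a <= b -> (i, a) \in p.
Proof.
move=> dp; elim: b => [|b IHb] bp; first by rewrite leqn0 => /eqP ->.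
rewrite leq_eqVlt => /orP[/eqP-> //|]; apply: IHb.
by apply: dp bp; rewrite /covers eqxx orbT.
Qed.

Lemma eq_linext p q s : p =i q -> linext p s -> linext q s.
Proof.
elim: s p q => //= y s IHs p q epq [yp py ls]; split; first by rewrite -epq.
  by move=> x /py; rewrite epq.
by apply: IHs ls => z; rewrite !inE epq.
Qed.

Lemma linext_swap p x y s : ~~ covers x y -> linext p (x :: y :: s) ->
  linext p (y :: x :: s).
Proof.
move=> nc /= [xp px [+ py ls]].
rewrite inE negb_or => /andP[yx yp]; split=> //.
  move=> z czy; have:= py z czy; rewrite inE => /orP[/eqP ezx|//].
  by rewrite -ezx czy in nc.
split; first by rewrite inE negb_or eq_sym yx.
  by move=> z /px; rewrite inE => ->; rewrite orbT.
by apply: eq_linext ls => z; rewrite !inE orbCA.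
Qed.

Lemma linext_toggle i p w : linext p w -> linext p (toggle i w).
Proof.
elim: i p w => [|i IHi] p [|x s] //.
  by case: s => [|y s] //= ls; case: ifPn => // nc; apply: linext_swap.
by case=> xp px ls; split=> //; apply: IHi.
Qed.

Lemma linext_run ts p w : linext p w -> linext p (run ts w).
Proof. by elim: ts w => //= i ts IHts w lw; apply: IHts; apply: linext_toggle. Qed.

Lemma linext_cat p a b :
  linext p (a ++ b) <-> linext p a /\ linext (catrev a p) b.
Proof.
elim: a p => [|y a IHa] p /=; first by split=> [|[]].
split=> [[yp py /IHa[]]|[[yp py la lb]]] //; by split=> //; apply/IHa.
Qed.

Lemma ideal_linext p s : ideal p -> linext p s -> ideal (catrev s p).
Proof.
elim: s p => //= y s IHs p dp [yp py ls].
by apply: IHs ls; apply: ideal_cons.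
Qed.

Lemma linext_disjoint_uniq p s :
  linext p s -> {in s, forall x, x \notin p} /\ uniq s.
Proof.
elim: s p => [//|y s IHs] p /= [yp _ /IHs[dis us]]; split=> [x|].
  by rewrite inE => /orP[/eqP->//|/dis]; rewrite inE negb_or => /andP[].
by rewrite us andbT; apply/negP => /dis; rewrite inE eqxx.
Qed.

(** * Toggles *)

Lemma size_toggle i w : size (toggle i w) = size w.
Proof.
elim: i w => [|i IHi] [|x s] //=; last by rewrite IHi.
by case: s => [|y s] //=; case: ifP.
Qed.

Lemma size_run ts w : size (run ts w) = size w.
Proof. by elim: ts w => //= i ts IHts w; rewrite IHts size_toggle. Qed.

Lemma perm_toggle i w : perm_eq (toggle i w) w.
Proof.
elim: i w => [|i IHi] [|x s] //=; last by rewrite perm_cons.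
case: s => [|y s] //=; case: ifP => // _.
by rewrite -[y :: _]/([:: y] ++ [:: x] ++ s) perm_catCA.
Qed.

Lemma perm_run ts w : perm_eq (run ts w) w.
Proof.
elim: ts w => //= i ts IHts w.
exact: perm_trans (IHts _) (perm_toggle _ _).
Qed.


Lemma toggleK p i w : linext p w -> toggle i (toggle i w) = w.
Proof.
elim: i p w => [|i IHi] p [|x s] //=; last by case=> _ _ /IHi ->.
case: s => [|y s] //= [_ px [+ _ _]]; case: ifPn => [/= -> //|_ /=].
by rewrite inE negb_or; case: ifP => // /px -> /andP[].
Qed.

Lemma nth_toggle d j k w :
  k != j -> k != j.+1 -> nth d (toggle j w) k = nth d w k.
Proof.
elim: j k w => [|j IHj] k [|x s] //=; last by case: k => //= k; exact: IHj.
by case: s => [|y s] //=; case: ifP => // _; case: k => [|[]].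
Qed.

Lemma desc_toggle_far i j w :
  (i.+1 < j) || (j.+1 < i) -> desc i (toggle j w) = desc i w.
Proof. by move=> ij; rewrite /desc !nth_toggle //; lia. Qed.

Lemma desc_run_far i ts w : all (fun j => (i.+1 < j) || (j.+1 < i)) ts ->
  desc i (run ts w) = desc i w.
Proof.
by elim: ts w => //= j ts IHts w /andP[ij /IHts ->]; rewrite desc_toggle_far.
Qed.

Lemma toggleC i j w : i.+1 < j -> toggle i (toggle j w) = toggle j (toggle i w).
Proof.
elim: i j w => [|i IHi] [|j] // [|x s] //= ij; last by rewrite IHi.
case: j ij s => // j _ [|y s] //=; by case: ifP.
Qed.

Lemma run_cat ts us w : run (ts ++ us) w = run us (run ts w).
Proof. exact: foldl_cat. Qed.

Lemma run_snoc ts i w : run (rcons ts i) w = toggle i (run ts w).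
Proof. exact: foldl_rcons. Qed.

Lemma toggleC_run j ts w : all (fun i => i.+1 < j) ts ->
  run ts (toggle j w) = toggle j (run ts w).
Proof. by elim: ts w => //= i ts IHts w /andP[ij]; rewrite toggleC //; apply: IHts. Qed.


(** * Descents under toggles *)

(** If two consecutive boxes share a row, then the box just left of the second
    one must be present already, so it is the first one. *)
Lemma same_row_covers p x y s :
  ideal p -> linext p (x :: y :: s) -> x.1 = y.1 -> covers x y.
Proof.
move=> dp /= [xp px [yxp py _]] exy.
have ex : x = (x.1, x.2) by case: (x).
have ey : y = (x.1, y.2) by rewrite exy; case: (y).
move: yxp; rewrite inE negb_or => /andP[yx yp].
(* If [y] were not to the right of [x], then [y] would be in [p] already. *)
have [ba|] := leqP y.2 x.2.
  move: ba; rewrite leq_eqVlt => /orP[/eqP e2|].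
    by case/eqP: yx; rewrite ex ey e2.
  case e2: x.2 => [//|b] yb; case/negP: yp; rewrite ey.
  by apply: (@ideal_row p x.1 y.2 b dp _ yb); apply: px; rewrite ex e2 /covers eqxx orbT.
case e2: y.2 => [//|b] xb.
have /py : covers (x.1, b) y by rewrite ey e2 /covers eqxx orbT.
rewrite inE => /orP[/eqP eb|bp]; first by rewrite ey e2 -eb /covers eqxx orbT.
by case/negP: xp; rewrite ex; apply: (@ideal_row p x.1 x.2 b dp bp).
Qed.

(** Two consecutive covers cannot turn: the fourth corner of the square would
    have to lie strictly between [h] and [y], where there is only [x]. *)
Lemma same_direction p h x y s : ideal p -> linext p (h :: x :: y :: s) ->
  covers h x -> covers x y -> (h.1 == x.1) = (x.1 == y.1).
Proof.
move=> dp /= [hp ph [xp px [yp py _]]] /coversP hx /coversP xy.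
(* [z] is the fourth corner of the square spanned by a turn at [x]. *)
have diag z : covers h z -> covers z y -> z != x -> False.
  move=> hz zy zx; have:= py z zy; rewrite !inE (negPf zx) /=.
  case/orP=> [/eqP ezh|zp].
    by move/coversP: hz; rewrite ezh; case: (h) => a b [] []; lia.
  by case/negP: hp; apply: dp zp.
case: hx xy diag => -> [] -> diag /=; try lia.
  by case: (diag (h.1, h.2.+1)); rewrite /covers ?eqxx ?orbT // xpair_eqE; lia.
by case: (diag (h.1.+1, h.2)); rewrite /covers ?eqxx ?orbT // xpair_eqE; lia.
Qed.

(** One slide step past two consecutive entries keeps their relative position.
    An entry that moves goes to the box directly west, in the same row, or
    directly north; in the latter case a change of relative position would
    require two consecutive boxes in one row that are not adjacent, or a turn. *)
Lemma desc_toggle_pair p i w : ideal p -> linext p w -> i.+2 < size w ->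
  desc i (toggle i.+1 (toggle i w)) = desc i.+1 w.
Proof.
elim: i p w => [|i IHi] p [|h w] //=; last first.
  case: w => [|x w] // dp [hp ph lw] sw.
  by apply: (IHi (h :: p)) => //; apply: ideal_cons.
case: w => [|x [|y s]] // dp lw _.
have hx : h.1 = x.1 -> covers h x := @same_row_covers p h x (y :: s) dp lw.
have xy : x.1 = y.1 -> covers x y.
  by case: lw => hp ph lw; apply: same_row_covers lw; apply: ideal_cons.
have sq := @same_direction p h x y s dp lw.
rewrite /=; case: ifPn => [chx|nhx] /=; case: ifPn => [cxy|nxy]; rewrite /desc /=.
- have := sq chx cxy; by move/coversP: cxy => [] ->; move/coversP: chx => [] -> /=; lia.
- have nexy : x.1 != y.1 by apply: contra nxy => /eqP/xy.
  by move/coversP: chx nexy => [] -> /=; lia.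
- have nehx : h.1 != x.1 by apply: contra nhx => /eqP/hx.
  by move/coversP: cxy nehx => [] -> /=; lia.
- by [].
Qed.

Lemma desc_toggle_pair_back p i w : ideal p -> linext p w -> i.+2 < size w ->
  desc i.+1 (toggle i (toggle i.+1 w)) = desc i w.
Proof.
move=> dp lw sw; rewrite -(@desc_toggle_pair p) ?size_toggle //.
  by rewrite !(@toggleK p) //; do ?exact: linext_toggle.
by do 2!apply: linext_toggle.
Qed.

(** Only the corner (0, 0) has no predecessor. *)
Lemma linext_head x s : linext [::] (x :: s) -> x = (0, 0).
Proof.
case=> _ px _; case: x px => [[|i] [|j]] px //.
- by have:= px (0, j); rewrite /covers eqxx orbT => /(_ isT).
- by have:= px (i, 0); rewrite /covers eqxx => /(_ isT).
- by have:= px (i, j.+1); rewrite /covers eqxx => /(_ isT).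
Qed.

(** The second box of a linear extension is always adjacent to the first. *)
Lemma toggle0 w : linext [::] w -> toggle 0 w = w.
Proof.
case: w => [|x [|y s]] // lw /=; case: ifPn => // /negP[].
have x0 := linext_head lw.
have [_ _ [yx py _]] := lw.
have cN z : covers z y -> z = (0, 0) by move/py; rewrite inE x0 => /eqP.
rewrite inE in yx.
case: y yx cN {lw py} => [[|i] [|j]]; rewrite ?x0 // => _ cN.
- by rewrite -(cN (0, j)) /covers eqxx ?orbT.
- by rewrite -(cN (i, 0)) /covers eqxx ?orbT.
- have := cN (i, j.+1); have := cN (i.+1, j).
  rewrite /covers !eqxx ?orbT => /(_ isT) <- /(_ isT) [] /eqP; lia.
Qed.

(** * Sweeps of toggles *)

Lemma iota_rcons k m : iota k m.+1 = rcons (iota k m) (k + m).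
Proof. by rewrite -addn1 iotaD cats1. Qed.

Lemma iota0_rcons m : iota 0 m.+1 = rcons (iota 0 m) m.
Proof. exact: iota_rcons. Qed.

Lemma all_iota0 (a : pred nat) m : (forall i, i < m -> a i) -> all a (iota 0 m).
Proof. by move=> am; apply/allP => i; rewrite mem_iota => /am. Qed.

(** The last toggle of the first sweep commutes past all of the second sweep but
    its last toggle, which peels off a pair t_(m+1), t_m. *)
Lemma desc_two_sweeps m w : linext [::] w -> m.+1 < size w ->
  desc m (run (iota 0 m.+1 ++ iota 0 m) w) = desc 0 w.
Proof.
elim: m w => [|m IHm] w lw sw; first by rewrite -[LHS]/(desc 0 (toggle 0 w)) toggle0.
rewrite run_cat [iota 0 m.+2]iota0_rcons run_snoc; set v := run _ w.
rewrite iota0_rcons run_snoc toggleC_run; last by apply: all_iota0 => i; lia.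
rewrite /v -run_cat (@desc_toggle_pair_back [::]) ?size_run //; last exact: linext_run.
by apply: IHm => //; lia.
Qed.

(** Only the consecutive toggles j and j + 1 affect the two boxes concerned. *)
Lemma desc_sweep m j w : linext [::] w -> m < size w -> j.+1 < m ->
  desc j (run (iota 0 m) w) = desc j.+1 w.
Proof.
move=> lw mw jm.
have -> : iota 0 m = iota 0 j ++ iota j 2 ++ iota (j + 2) (m - j.+2).
  by rewrite -iotaD -[X in iota X (2 + _)]add0n -iotaD; congr iota; lia.
rewrite !run_cat desc_run_far; last by apply/allP => i; rewrite mem_iota; lia.
rewrite (@desc_toggle_pair [::]) ?size_run //; [|exact: linext_run|lia].
by rewrite desc_run_far //; apply: all_iota0 => i; lia.
Qed.

Lemma evac_toggles_lt m : all (fun i => i < m) (evac_toggles m).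
Proof.
elim: m => // m IHm; rewrite /evac_toggles -/evac_toggles all_cat.
rewrite all_iota0 //=; apply: sub_all IHm => i; lia.
Qed.

Lemma evac_togglesS m : evac_toggles m.+1 = iota 0 m.+1 ++ evac_toggles m.
Proof. by []. Qed.

Lemma evac_toggles_pred m : evac_toggles m = iota 0 m ++ evac_toggles m.-1.
Proof. by case: m. Qed.

(** Each sweep shifts descents one step down.  The descent that reaches the bottom
    is sent to the top by two sweeps, after which it is left alone. *)
Lemma desc_evac m i w : linext [::] w -> m < size w -> i < m ->
  desc i (run (evac_toggles m) w) = desc (m.-1 - i) w.
Proof.
elim: m i w => [|m IHm] i w lw mw im //.
rewrite evac_togglesS run_cat.
move: im; rewrite ltnS leq_eqVlt => /orP[/eqP->|im].
  rewrite subnn evac_toggles_pred run_cat desc_run_far.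
    by rewrite -run_cat desc_two_sweeps.
  by apply: sub_all (evac_toggles_lt _) => j; lia.
rewrite IHm ?size_run //; [|exact: linext_run|lia].
by rewrite desc_sweep //; [congr desc; lia | lia].
Qed.

(** A second decomposition of dual evacuation, in which the longest sweep comes
    last and runs downwards; it will cancel against an upward sweep. *)
Lemma run_evac_toggles m w :
  run (evac_toggles m) w = run (evac_toggles m.-1 ++ rev (iota 0 m)) w.
Proof.
elim: m w => // m IHm w; rewrite evac_togglesS run_cat IHm run_cat.
rewrite -[m.+1.-1]/m [evac_toggles m]evac_toggles_pred iota0_rcons rev_rcons run_snoc.
rewrite toggleC_run; last by apply: sub_all (evac_toggles_lt _) => j; lia.
by rewrite -cat1s !run_cat.
Qed.

Lemma run_rev_iotaS m w :
  run (rev (iota 0 m.+1)) w = run (rev (iota 0 m)) (toggle m w).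
Proof. by rewrite iota0_rcons rev_rcons. Qed.

Lemma run_revK ts w : linext [::] w -> run (rev ts) (run ts w) = w.
Proof.
elim/last_ind: ts => [//|ts i IHts] lw; rewrite rev_rcons run_snoc /=.
by rewrite (@toggleK [::]) ?IHts //; apply: linext_run.
Qed.

(** With v the word obtained from w by the upward sweep, w is in turn a downward
    sweep of v, so that the promotion of w is two downward sweeps of v.  They
    regroup into pairs t_i, t_(i+1), each lowering the descent by one. *)
Lemma desc_promotion m w : linext [::] w -> m.+1 < size w ->
  desc 0 (run (rev (iota 0 m.+1)) w) = desc m (run (iota 0 m) w).
Proof.
move=> lw mw; rewrite -[w in LHS](run_revK (iota 0 m)) //.
move: (run _ w) (linext_run (iota 0 m) lw) (size_run (iota 0 m) w) mw => v lv <-.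
elim: m v lv => [|m IHm] v lv mv; first by rewrite -[LHS]/(desc 0 (toggle 0 v)) toggle0.
rewrite -(@desc_toggle_pair [::] m v) //.
rewrite -IHm; [|by do 2 apply: linext_toggle|by rewrite !size_toggle; lia].
rewrite (run_rev_iotaS m.+1) [X in toggle m.+1 X]run_rev_iotaS.
by rewrite [in RHS]toggleC_run // all_rev; apply: all_iota0 => j; lia.
Qed.

(** If the last two boxes were adjacent, the box next to the second one on its
    antidiagonal would be present, and would have come after the first one. *)
Lemma desc_toggle_last m w : linext [::] w -> size w = m.+2 ->
  (forall i j, ((i.+1, j) \in w) = ((i, j.+1) \in w)) ->
  desc m (toggle m w) = ~~ desc m w.
Proof.
move=> lw sw stair.
have [p [x [y ew]]] : exists p x y, w = p ++ [:: x; y].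
  case/lastP: w sw {lw stair} => // w y; case/lastP: w => // w x _.
  by exists w, x, y; rewrite -!cats1 -catA.
have sp : size p = m by move: sw; rewrite ew size_cat /=; lia.
move: lw; rewrite ew => /linext_cat[lp lxy].
have dp := ideal_linext ideal_nil lp.
have [xp _ [yp _ _]] := lxy.
have last2 : toggle m w = p ++ toggle 0 [:: x; y].
  by rewrite ew -sp; elim: (p) => //= z r ->.
have ncxy : ~~ covers x y.
  (* Nothing in the word but [y] can come after [x]. *)
  have corner z : z \in w -> covers x z -> z != y -> False.
    rewrite ew mem_cat !inE => zw xz zy; case/negP: xp.
    case/or3P: zw => [zp|/eqP ezx|/eqP ezy]; last by rewrite ezy eqxx in zy.
      by apply: dp xz _; rewrite catrevE cats0 mem_rev.
    by move/coversP: xz; rewrite ezx; case: (x) => a b /= [] [] *; lia.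
  have yw : y \in w by rewrite ew mem_cat !inE eqxx !orbT.
  apply/negP=> /coversP[] ey; move: yw; rewrite ey.
    rewrite stair => /corner; rewrite /covers eqxx orbT ey xpair_eqE => /(_ isT).
    by case; lia.
  rewrite -stair => /corner; rewrite /covers eqxx ey xpair_eqE => /(_ isT).
  by case; lia.
rewrite -ew last2 /= (negPf ncxy) /desc ew !nth_cat sp ltnn subnn.
rewrite [m.+1 < m]ltnNge leqnSn subSnn /=.
have : x.1 != y.1 by apply: contra ncxy => /eqP; apply: same_row_covers dp lxy.
lia.
Qed.

Lemma desc_promotion_evac m w : linext [::] w -> size w = m.+2 ->
    (forall i j, ((i.+1, j) \in w) = ((i, j.+1) \in w)) ->
  desc 0 (run (rev (iota 0 m.+1)) (run (evac_toggles m.+1) w)) =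
  ~~ desc 0 (run (rev (iota 0 m.+1)) w).
Proof.
move=> lw sw stair.
rewrite !desc_promotion ?size_run ?sw //; last exact: linext_run.
rewrite run_evac_toggles run_cat run_rev_iotaS -[m.+1.-1]/m; set z := run _ w.
have lz : linext [::] z by apply: linext_run.
(* The downward sweep cancels against the upward one, except for its first
   toggle. *)
rewrite -{1}[iota 0 m]revK run_revK; last exact: linext_toggle.
rewrite desc_toggle_last ?size_run // => [|i j]; last by rewrite !(perm_mem (perm_run _ _)).
rewrite /z evac_toggles_pred run_cat desc_run_far //.
by apply: sub_all (evac_toggles_lt _) => j; lia.
Qed.

(** * Slides as sweeps *)

(** A slide read off the word: the empty box [h] meets the boxes of [s] in turn
    and moves to each one that [r] relates it to; the last box of the result is
    the end of the sliding path. *)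
Fixpoint scan (r : rel box) (h : box) (s : seq box) : seq box :=
  if s is x :: s' then
    if r h x then h :: scan r x s' else x :: scan r h s'
  else [:: h].

Lemma toggle_rcons i u g :
  i.+1 < size u -> toggle i (rcons u g) = rcons (toggle i u) g.
Proof.
elim: i u => [|i IHi] [|x u] //=; last by move=> iu; rewrite IHi.
by case: u => [|y u] //= _; case: ifP.
Qed.

Lemma run_prefix ts u g : all (fun i => i.+1 < size u) ts ->
  run ts (rcons u g) = rcons (run ts u) g.
Proof.
elim: ts u => //= i ts IHts u /andP[iu tsu].
by rewrite toggle_rcons // IHts // size_toggle.
Qed.

Lemma run_shift ts x s : run (map succn ts) (x :: s) = x :: run ts s.
Proof. by elim: ts s => //= i ts IHts s; rewrite IHts. Qed.

Lemma scan_run h s : scan covers h s = run (iota 0 (size s)) (h :: s).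
Proof.
elim: s h => //= x s IHs h.
by rewrite (iotaDl 1 0) /=; case: ifP => _; rewrite IHs run_shift.
Qed.

Lemma scan_run_rev q h :
  rev (scan (fun x y => covers y x) h (rev q)) =
  run (rev (iota 0 (size q))) (rcons q h).
Proof.
elim/last_ind: q h => // q x IHq h.
rewrite rev_rcons size_rcons run_rev_iotaS /=.
have -> : toggle (size q) (rcons (rcons q x) h) =
    if covers x h then rcons (rcons q x) h else rcons (rcons q h) x.
  by elim: q {IHq} => [|y q /= ->] /=; case: ifP.
by case: ifP => _; rewrite rev_cons IHq [in RHS]run_prefix // size_rcons all_rev;
  apply: all_iota0 => i; rewrite ltnS.
Qed.

(** Both kinds of slide are scans, one of the increasing word and one of the
    decreasing word.  [ready h s] expresses that the empty box [h] has already
    been compared with all entries but those of [s], which is all that is needed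
    for the next step of the slide to be dictated by the first box of [s] that is
    related to [h]. *)
Section Sliding.

Variables (r : rel box) (step : filling * box -> filling * box) (lt : rel nat).
Variable (ready : box -> seq box -> Prop).
Hypothesis ready_stop : forall T h, ready h [::] -> step (T, h) = (T, h).
Hypothesis ready_skip : forall h x s, ready h (x :: s) -> ~~ r h x -> ready h s.
Hypothesis ready_move : forall h x s, ready h (x :: s) -> r h x -> ready x s.
Hypothesis step_move : forall T h x s, ready h (x :: s) -> r h x ->
  {in s, forall y, lt (T x) (T y)} -> step (T, h) = slide_from T h x.

(** The number of steps is only bounded, since skipped boxes cost none; the
    final state being a fixed point, further steps are harmless. *)
Lemma slide_scan T h s : ready h s -> uniq (h :: s) ->
    pairwise lt (map T s) ->
  exists k u g T', [/\ scan r h s = rcons u g, iter k step (T, h) = (T', g),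
    step (T', g) = (T', g), map T' u = map T s
      & k <= size s /\ {in predC (mem (h :: s)), T' =1 T}].
Proof.
elim: s T h => [|x s IHs] T h rdy.
  by exists 0, [::], h, T; split=> //; apply: ready_stop.
rewrite /= inE negb_or -andbA => /and4P[hx hs xs us] /andP[].
rewrite all_map => /allP ltx lts.
have [rhx|nrhx] := boolP (r h x); last first.
  have [||k [u [g [T' [-> e1 e2 e3 [ks e4]]]]]] := IHs T h (ready_skip rdy nrhx).
  - by rewrite /= hs.
  - by [].
  exists k, (x :: u), g, T'; split=> //=; first by rewrite e3 e4 // !inE negb_or eq_sym hx.
  split=> [|z]; first exact: ltnW.
  by rewrite !inE !negb_or => /and3P[zh zx zs]; apply: e4; rewrite !inE negb_or zh.
set T1 := upd T h (T x).
have T1s : {in s, T1 =1 T}.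
  by move=> z zs; rewrite /T1 /upd; case: eqP => // ezh; rewrite -ezh zs in hs.
have mapT1 : map T1 s = map T s by apply/eq_in_map.
have [||k [u [g [T' [-> e1 e2 e3 [ks e4]]]]]] := IHs T1 x (ready_move rdy rhx).
- by rewrite /= xs.
- by rewrite mapT1.
exists k.+1, (h :: u), g, T'; split=> //=.
- by rewrite -iterS iterSr (step_move rdy rhx).
- by rewrite e3 mapT1 e4 ?inE ?negb_or ?hx // /T1 /upd eqxx.
split=> // z; rewrite !inE !negb_or => /and3P[zh zx zs].
by rewrite e4 ?inE ?negb_or ?zx // /T1 /upd (negPf zh).
Qed.

End Sliding.

Lemma upd_same T b v : upd T b v b = v.
Proof. by rewrite /upd eqxx. Qed.

Lemma upd_other T b v c : c != b -> upd T b v c = T c.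
Proof. by rewrite /upd => /negPf->. Qed.

(** [p] collects the boxes that have been passed, [h] included: none of them lies
    directly south or east of [h]. *)
Definition ready_se (D : seq box) (h : box) (s : seq box) : Prop :=
  exists p, [/\ ideal p, h \in p, linext p s, D =i p ++ s
             & forall y, covers h y -> y \notin p].

Lemma slide_se_scan D T h s : linext [::] (h :: s) -> perm_eq (h :: s) D ->
    pairwise ltn (map T s) ->
  exists u g T', [/\ scan covers h s = rcons u g,
    iter (size D) (slide_se D) (T, h) = (T', g) & map T' u = map T s].
Proof.
move=> lw pD lts.
have rdyD h' s' y : ready_se D h' s' -> covers h' y -> (y \in D) = (y \in s').
  by case=> p [_ _ _ -> np] /np yp; rewrite mem_cat (negPf yp).
have cS h' : covers h' (h'.1.+1, h'.2) by rewrite /covers eqxx.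
have cE h' : covers h' (h'.1, h'.2.+1) by rewrite /covers eqxx orbT.
have [|||||||k [u [g [T' [e1 e2 e3 e4 [ks _]]]]]] :=
  @slide_scan covers (slide_se D) ltn (ready_se D) _ _ _ _ T h s.
- move=> T1 h1 rdy; rewrite /slide_se /=.
  by rewrite !(rdyD _ _ _ rdy).
- move=> h1 x s1 [p [dp hp [xp px ls] Dp np]] nhx; exists (x :: p); split=> //.
  + exact: ideal_cons.
  + by rewrite inE hp orbT.
  + by move=> z; rewrite Dp !(inE, mem_cat) orbCA.
  + move=> y hy; rewrite inE negb_or np // andbT.
    by apply: contra nhx => /eqP <-.
- move=> h1 x s1 [p [dp hp [xp px ls] Dp np]] nhx; exists (x :: p); split=> //.
  + exact: ideal_cons.
  + by rewrite inE eqxx.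
  + by move=> z; rewrite Dp !(inE, mem_cat) orbCA.
  + move=> y xy; rewrite inE negb_or; apply/andP; split.
      by move/coversP: xy; case: (x) => a b [] ->; rewrite xpair_eqE /=; lia.
    by apply: contra xp; apply: dp.
- move=> T1 h1 x s1 rdy hx ltx.
  have lt1 y : covers h1 y -> y \in D -> y != x -> T1 x < T1 y.
    by move=> hy; rewrite (rdyD _ _ _ rdy) // inE => /orP[->//|/ltx].
  have xD : x \in D by rewrite (rdyD _ _ _ rdy) // inE eqxx.
  rewrite /slide_se /=; case/coversP: hx lt1 xD => -> lt1 xD; rewrite xD.
    have := lt1 _ (cE h1); case: ifP => // _ /(_ isT).
    by rewrite xpair_eqE (gtn_eqF (ltnSn _)) andbF => /(_ isT) ->.
  have := lt1 _ (cS h1); case: ifP => // _ /(_ isT).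
  rewrite xpair_eqE (gtn_eqF (ltnSn _)) => /(_ isT) lxy.
  by rewrite ltnNge (ltnW lxy).
- exists [:: h]; have [_ ph ls] := lw; split=> //.
  + exact: ideal_cons.
  + by rewrite inE.
  + by move=> z; rewrite -(perm_mem pD).
  + move=> y hy; rewrite inE; move/coversP: hy.
    by case: (h) => a b [] ->; rewrite xpair_eqE /=; lia.
- by have [] := linext_disjoint_uniq lw.
- by [].
exists u, g, T'; split=> //.
have -> : size D = size D - k + k.
  by rewrite subnK // -(perm_size pD) ltnW.
rewrite iterD e2; elim: (size D - k) => //= j ->; exact: e3.
Qed.

(** The recursion on the shape follows the word: a slide turns the word into one
    that ends with the box to be deleted, and the remaining toggles only act on
    what precedes that box. *)
Lemma dual_evac_rec_word m D T E w :
    size w = m -> perm_eq w D -> linext [::] w -> pairwise ltn (map T w) ->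
  map (dual_evac_rec m D T E) (run (evac_toggles m.-1) w) = iota 1 m /\
  {in predC (mem D), dual_evac_rec m D T E =1 E}.
Proof.
elim: m D T E w => [|m IHm] D T E w; first by move/size0nil->.
case: w => // h s [sm] pD lw /= /andP[_ lts].
have uD : uniq D by rewrite -(perm_uniq pD); have [] := linext_disjoint_uniq lw.
have [u [g [T' [sc it mT]]]] := slide_se_scan lw pD lts.
rewrite -(linext_head lw) it /= => {it}.
have su : size u = m by rewrite -(size_map T') mT size_map.
rewrite scan_run sm in sc.
have pug : perm_eq (rcons u g) D.
  by rewrite -sc; apply: perm_trans pD; apply: perm_run.
have gD : g \in D by rewrite -(perm_mem pug) mem_rcons inE eqxx.
have pu : perm_eq u (rem g D).
  by rewrite -(perm_cons g) -(permPr (perm_to_rem gD)) -perm_rcons.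
have lu : linext [::] u.
  have := linext_run (iota 0 m) lw; rewrite sc -cats1.
  by case/linext_cat.
have [||||IH1 IH2] := IHm (rem g D) T' (upd E g m.+1) u => //; first by rewrite mT.
split; last first.
  move=> b; rewrite inE /= => bD; rewrite IH2 ?upd_other //.
    by apply: contraNneq bD => ->.
  by rewrite inE /=; apply: contra bD => /mem_rem.
rewrite evac_toggles_pred run_cat sc run_prefix; last first.
  by apply: sub_all (evac_toggles_lt _) => i; rewrite su; lia.
rewrite map_rcons IH1 IH2 ?upd_same; last by rewrite inE /= mem_rem_uniq // inE eqxx.
by rewrite -[RHS]/(iota 1 m.+1) iota_rcons.
Qed.

Definition ready_nw (h : box) (s : seq box) : Prop :=
  linext [::] (rcons (rev s) h).

(** This counts the slides: the empty box reaches (0, 0) neither before nor after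
    the prescribed number of them. *)
Lemma slide_nw_sum k T b : let s := iter k slide_nw (T, b) in
  s.2.1 + s.2.2 = b.1 + b.2 - k.
Proof.
elim: k => [|k] /=; first by rewrite subn0.
case: (iter k _ _) => T1 [[|i] [|j]] /=; try lia.
by rewrite /slide_nw /=; case: ifP => _ /=; lia.
Qed.

Lemma slide_nw_scan T h s : ready_nw h s -> uniq (h :: s) ->
    pairwise gtn (map T s) ->
  exists u T', [/\ scan (fun x y => covers y x) h s = rcons u (0, 0),
    iter (h.1 + h.2) slide_nw (T, h) = (T', (0, 0)) & map T' u = map T s].
Proof.
move=> rdy us lts.
have parent h1 s1 x : ready_nw h1 s1 -> covers x h1 -> x \in s1.
  rewrite /ready_nw -cats1 => /linext_cat[_ [_ px _]] /px.
  by rewrite catrevE cats0 revK.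
have [|||||||k [u [g [T' [e1 e2 e3 e4 _]]]]] :=
  @slide_scan (fun x y => covers y x) slide_nw gtn ready_nw _ _ _ _ T h s => //.
- by move=> T1 h1 lw; rewrite (@linext_head h1 [::] lw).
- move=> h1 x s1; rewrite /ready_nw rev_cons -!cats1 -catA => lw nc.
  apply/linext_cat; have /linext_cat[ls lxh] := lw.
  by split=> //; case: (linext_swap nc lxh).
- by move=> h1 x s1; rewrite /ready_nw rev_cons -!cats1 => /linext_cat[].
- move=> T1 h1 x s1 /parent pa xh ltx.
  have lt1 y : covers y h1 -> y != x -> T1 y < T1 x.
    by move/pa; rewrite inE => /orP[->//|/ltx].
  case/coversP: xh lt1 {pa ltx} => -> lt1; case: x lt1 => i j /= lt1.
    case: j lt1 => // j /(_ (i.+1, j)); rewrite /covers eqxx orbT xpair_eqE.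
    by rewrite (gtn_eqF (ltnSn _)) => /(_ isT isT); rewrite /slide_nw /= => ->.
  case: i lt1 => // i /(_ (i, j.+1)); rewrite /covers eqxx /= xpair_eqE.
  rewrite (ltn_eqF (ltnSn _)) => /(_ isT isT) lt1.
  by rewrite /slide_nw /= ltnNge (ltnW lt1).
have g0 : g = (0, 0).
  have := congr1 snd e3; case: g {e1 e2 e3} => [[|i] [|j]] //=;
    [by case; lia | by case; lia |].
  by rewrite /slide_nw /=; case: ifP => _ /= []; lia.
subst g; exists u, T'; split=> //.
have := slide_nw_sum k T h; rewrite e2 /= => /esym/eqP; rewrite subn_eq0 => hk.
have := slide_nw_sum (h.1 + h.2) T h; rewrite subnn.
move: e2; rewrite -(subnK hk) iterD.
case: (iter (h.1 + h.2) _ _) => T1 [i j] /= it /eqP.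
rewrite addn_eq0 => /andP[/eqP i0 /eqP j0].
by rewrite -it i0 j0; elim: (k - _) => //= l <-.
Qed.

(** * Tableaux as words of boxes *)

Lemma entry_index (T : filling) w b : map T w = iota 1 (size w) -> b \in w ->
  T b = (index b w).+1.
Proof.
move=> mT bw; rewrite -{1}(nth_index (0, 0) bw) -(nth_map _ 0) ?index_mem //.
by rewrite mT nth_iota ?index_mem.
Qed.

Lemma entry_inj (T : filling) w :
  map T w = iota 1 (size w) -> {in w &, injective T}.
Proof.
move=> mT b c bw cw; rewrite !(entry_index mT) // => -[ibc].
by rewrite -(nth_index (0, 0) bw) ibc nth_index.
Qed.

Lemma promotion_word la T q h : let w := rcons q h in
    perm_eq w (diagram la) -> linext [::] w -> map T w = iota 1 (size w) ->
    sumn la = size w ->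
  map (promotion la T) (run (rev (iota 0 (size q))) w) = iota 1 (size w).
Proof.
move=> w pD lw mT sla.
have uw : uniq w by have [] := linext_disjoint_uniq lw.
have /rcons_inj[mq Th] :
    rcons (map T q) (T h) = rcons (iota 1 (size q)) (size q).+1.
  by rewrite -map_rcons mT size_rcons iota_rcons.
have hD : h \in diagram la by rewrite -(perm_mem pD) mem_rcons inE eqxx.
have hn : box_of (diagram la) T (sumn la) = h.
  have hs : has (fun b => T b == sumn la) (diagram la).
    by apply/hasP; exists h => //; rewrite Th sla size_rcons.
  apply: (entry_inj mT); rewrite ?(perm_mem pD) //.
    by rewrite /box_of mem_nth // -has_find.
  by rewrite (eqP (nth_find (0, 0) hs)) Th sla size_rcons.
have [|||u [T' [sc it mT']]] := @slide_nw_scan T h (rev q).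
- by rewrite /ready_nw revK.
- by rewrite -rev_rcons rev_uniq.
- rewrite map_rev mq -(sorted_pairwise (rev_trans ltn_trans)) rev_sorted.
  exact: iota_ltn_sorted.
move: (perm_run (rev (iota 0 (size q))) w); rewrite -scan_run_rev sc rev_rcons.
move=> pw; have gu : (0, 0) \notin u.
  by move: uw; rewrite -(perm_uniq pw) /= mem_rev => /andP[].
have prom b : b \in w -> promotion la T b = (upd T' (0, 0) 0 b).+1.
  by rewrite (perm_mem pD) /promotion hn it /= => ->.
have -> : map (promotion la T) ((0, 0) :: rev u) =
          map (fun b => (upd T' (0, 0) 0 b).+1) ((0, 0) :: rev u).
  by apply/eq_in_map => b; rewrite (perm_mem pw) => /prom.
rewrite size_rcons /= upd_same (iotaDl 1 1); congr (_ :: _).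
rewrite -mq -[map T q]revK -map_rev -mT' -map_rev -map_comp.
apply/eq_in_map => b; rewrite mem_rev => bu /=.
by rewrite upd_other //; apply: contraNneq gu => <-.
Qed.

Lemma Des_word la T w i : perm_eq w (diagram la) -> uniq w ->
    map T w = iota 1 (size w) -> 0 < i < size w ->
  Des la T i = desc i.-1 w.
Proof.
move=> pD uw mT /andP[i0 iw].
have box_val j : j < size w -> T (nth (0, 0) w j) = j.+1.
  by move=> jw; rewrite (entry_index mT) ?mem_nth // index_uniq.
have val_box b j :
    j < size w -> b \in diagram la -> T b = j.+1 -> b = nth (0, 0) w j.
  move=> jw bD Tb; apply: (entry_inj mT);
    by rewrite ?(perm_mem pD) ?box_val // -(perm_mem pD) mem_nth.
have nD j : j < size w -> nth (0, 0) w j \in diagram la.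
  by move=> jw; rewrite -(perm_mem pD) mem_nth.
case: i i0 iw => // i _ iw; rewrite /Des /desc /=; apply/hasP/idP.
  case=> b bD /hasP[c cD /and3P[/eqP Tb /eqP Tc]].
  by rewrite (val_box b i (ltnW iw)) // (val_box c i.+1 iw).
move=> lt; exists (nth (0, 0) w i); first exact/nD/ltnW.
apply/hasP; exists (nth (0, 0) w i.+1); first exact: nD.
by rewrite !box_val ?eqxx //; exact: ltnW.
Qed.

Lemma mem_staircase k i j : ((i, j) \in diagram (staircase k)) = (i + j < k).
Proof.
have st : nth 0 (staircase k) i = k - i.
  have [ik|ki] := ltnP i k.
    by rewrite nth_rev size_iota // nth_iota; lia.
  by rewrite nth_default ?size_rev ?size_iota; lia.
apply/allpairsPdep/idP => [[a [b [+ + [ea eb]]]]|ijk].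
  by rewrite -ea -eb st !mem_iota; lia.
by exists i, j; rewrite !mem_iota st size_rev size_iota; split=> //; lia.
Qed.

Lemma size_diagram la : size (diagram la) = sumn la.
Proof.
rewrite size_allpairs_dep -[in RHS](mkseq_nth 0 la); congr sumn.
by apply: eq_map => i; rewrite size_iota.
Qed.

Lemma uniq_diagram la : uniq (diagram la).
Proof.
apply: allpairs_uniq_dep => [|i _|]; rewrite ?iota_uniq //.
by move=> [i j] [i' j'] _ _ /= [-> ->].
Qed.

Lemma sumn_staircase k : sumn (staircase k) = (k * k.+1)./2.
Proof.
rewrite sumn_rev; elim: k => // k IHk.
by rewrite iota_rcons sumn_rcons IHk; lia.
Qed.

Lemma increasing_linext (T : filling) p s :
    (forall x y, covers x y -> y \in p ++ s -> x \in p ++ s /\ T x < T y) ->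
    uniq (p ++ s) -> pairwise ltn (map T s) ->
  linext p s.
Proof.
elim: s p => //= y s IHs p closed ups /andP[]; rewrite all_map => /allP lty lts.
have eps : (y :: p) ++ s =i p ++ y :: s by move=> z; rewrite !(inE, mem_cat) orbCA.
split.
- by move: ups; rewrite -cat_rcons cat_uniq rcons_uniq => /andP[/andP[]].
- move=> x cxy; have [] := closed x y cxy; first by rewrite mem_cat inE eqxx orbT.
  rewrite mem_cat inE => /or3P[//|/eqP->|/lty /=]; first by rewrite ltnn.
  by move=> yx xy; have := ltn_trans yx xy; rewrite ltnn.
- apply: IHs lts => [x z cxz|]; first by rewrite !eps; apply: closed.
  by move: ups; rewrite -cat1s uniq_catCA.
Qed.

(** Sorting the boxes of the diagram by their entries gives the word. *)
Lemma tableau_word k T : SYT (staircase k) T ->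
  exists w, [/\ perm_eq w (diagram (staircase k)), linext [::] w
                & map T w = iota 1 (size w)].
Proof.
case=> _ bnd inj lte lts; set D := diagram _ in bnd inj lte lts *.
exists (sort (relpre T leq) D).
have pD : perm_eq (sort (relpre T leq) D) D by rewrite perm_sort.
have mT : map T (sort (relpre T leq) D) = iota 1 (size (sort (relpre T leq) D)).
  rewrite -sort_map size_sort; apply: (sorted_eq leq_trans anti_leq).
  - exact: sort_sorted leq_total _.
  - exact: iota_sorted.
  rewrite perm_sort; have uT : uniq (map T D).
    by rewrite map_inj_in_uniq ?uniq_diagram.
  apply: uniq_perm; rewrite ?iota_uniq //.
  have sub : {subset map T D <= iota 1 (size D)}.
    by move=> v /mapP[b bD ->]; rewrite mem_iota size_diagram add1n ltnS bnd.
  by have [] := uniq_min_size uT sub; rewrite ?size_iota ?size_map.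
split=> //; apply: (@increasing_linext T); last 2 first.
- by rewrite (perm_uniq pD) uniq_diagram.
- rewrite mT -(sorted_pairwise ltn_trans); exact: iota_ltn_sorted.
move=> x [i j] + ; rewrite !(perm_mem pD) => /coversP[] exy yD.
  move: exy yD; case: x => a b [-> ->] yD; split; last exact: lts.
  by move: yD; rewrite !mem_staircase; lia.
move: exy yD; case: x => a b [-> ->] yD; split; last exact: lte.
by move: yD; rewrite !mem_staircase; lia.
Qed.

(** * The circular descent array *)

Definition circular (n : nat) (f : nat -> bool) (g : bool) : seq bool :=
  [seq if i < n then f i else if i == n then ~~ g
       else if i < 2 * n then ~~ f (i - n) else g | i <- iota 1 (2 * n)].

Lemma nth_circular n f g a : a < 2 * n -> nth false (circular n f g) a =
  if a.+1 < n then f a.+1 else if a.+1 == n then ~~ g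
       else if a.+1 < 2 * n then ~~ f (a.+1 - n) else g.
Proof. by move=> an; rewrite (nth_map 0) ?size_iota // nth_iota. Qed.

(** The index on the right is n - 2 - a modulo 2 n: positions are numbered from 0
    here, so box a + 1 corresponds to box n - (a + 1). *)
Lemma nth_circular_flip n f g f' g' a : 1 < n ->
    (forall i, 0 < i < n -> f' i = f (n - i)) -> g' = ~~ g -> a < 2 * n ->
  nth false (circular n f' g') a =
  nth false (circular n f g) (if a.+1 < n then n - a.+2 else 3 * n - a.+2).
Proof.
move=> n1 ff -> an; rewrite !nth_circular //; last by case: ifP; lia.
case: (ltnP a.+1 n) => an1.
  rewrite ff; last lia.
  have -> : (n - a.+2).+1 = n - a.+1 by lia.
  by case: ifP => //; lia.
case: eqP => [an2|an2].
  have -> : (3 * n - a.+2).+1 = 2 * n by lia.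
  by rewrite negbK ltnn; do 2 (case: ifP; first lia).
case: ifP => [an3|an3].
  rewrite ff; last lia.
  have -> : n - (a.+1 - n) = (3 * n - a.+2).+1 - n by lia.
  do 2 (case: ifP; first lia); move=> _ _.
  by case: ifP => //; lia.
have -> : (3 * n - a.+2).+1 = n by lia.
by rewrite ltnn eqxx.
Qed.

Lemma circular_flip n s t : 0 < n -> size s = 2 * n -> size t = 2 * n ->
    (forall a, a < 2 * n ->
       nth false t a =
       nth false s (if a.+1 < n then n - a.+2 else 3 * n - a.+2)) ->
  t = rev (rotr n.+1 s) /\
  (forall i : int, circ_box t i <-> circ_box s (n%:Z - i)%R).
Proof.
move=> n0 ss st nt; split.
  apply: (@eq_from_nth _ false); first by rewrite size_rev size_rotr ss.
  move=> a; rewrite st => an; rewrite nt // nth_rev size_rotr ss // /rotr /rot.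
  rewrite nth_cat size_drop ss nth_drop; case: ifP => an1; case: ifP => an2; try lia.
    by rewrite nth_take; [congr nth|]; lia.
  by congr nth; lia.
move=> i; rewrite /circ_box ss st.
have n2 : Posz (2 * n) != 0%R by lia.
have := divz_eq (i - 1)%R (Posz (2 * n)); have := modz_ge0 (i - 1)%R n2.
have := ltz_pmod (i - 1)%R (_ : (0 < Posz (2 * n))%R).
move=> /(_ ltac:(lia)).
case: (modz _ _) => // a; move: (divz _ _) => q an _ ei.
rewrite [absz _]/= nt; last by lia.
set b := (X in nth false s X); have bn : b < 2 * n by rewrite /b; case: ifP; lia.
suff -> : ((n%:Z - i - 1) %% Posz (2 * n))%Z = b by [].
have -> : (n%:Z - i - 1 =
    (if (a.+1 < n)%N then - q else - q - 1) * Posz (2 * n) + b%:Z)%R.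
  by rewrite /b; case: ifP; lia.
by rewrite modzMDl modz_small //; lia.
Qed.

Theorem theorem4p14 (k : nat) (S : filling) (n : nat) :
  2 < k ->
  SYT (staircase k) S ->
  n = (k * k.+1)./2 ->
  Des_e k (dual_evac (staircase k) S) = rev (rotr n.+1 (Des_e k S)) /\
  (forall i : int,
     circ_box (Des_e k (dual_evac (staircase k) S)) i <->
     circ_box (Des_e k S) (n%:Z - i)%R).
Proof.
move=> k2 tabS en; set E := dual_evac _ S; set la := staircase k in tabS E *.
have [w [pD lw mS]] := tableau_word tabS.
have sw : size w = n by rewrite (perm_size pD) size_diagram sumn_staircase.
have sla : sumn la = n by rewrite sumn_staircase.
have uw : uniq w by have [] := linext_disjoint_uniq lw.
have [m nm] : exists m, n = m.+2 by exists n.-2; nia.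
have ltS : pairwise ltn (map S w).
  by rewrite mS -(sorted_pairwise ltn_trans) iota_ltn_sorted.
have stair i j : ((i.+1, j) \in w) = ((i, j.+1) \in w).
  by rewrite !(perm_mem pD) !mem_staircase addSnnS.
set v := run (evac_toggles m.+1) w.
have lv : linext [::] v by apply: linext_run.
have sv : size v = n by rewrite size_run.
have pvD : perm_eq v (diagram la) by apply: perm_trans pD; apply: perm_run.
have uv : uniq v by have [] := linext_disjoint_uniq lv.
have mE : map E v = iota 1 (size v).
  rewrite sv; have [] := dual_evac_rec_word (fun=> 0) sw pD lw ltS.
  by rewrite /E /dual_evac sla nm.
have Des1 T u : perm_eq u (diagram la) -> linext [::] u -> size u = n ->
    map T u = iota 1 (size u) ->
  Des la (promotion la T) 1 = desc 0 (run (rev (iota 0 m.+1)) u).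
  case/lastP: u => [|q h] pu lu su mT; first by rewrite nm in su.
  have sq : size q = m.+1 by move: su; rewrite size_rcons nm => -[].
  rewrite (@Des_word la _ (run (rev (iota 0 m.+1)) (rcons q h))) //.
  - by apply: perm_trans pu; apply: perm_run.
  - by rewrite (perm_uniq (perm_run _ _)); have [] := linext_disjoint_uniq lu.
  - by rewrite -sq (promotion_word pu lu mT) ?size_run ?su.
  - by rewrite size_run su nm.
have arr T : Des_e k T = circular n (Des la T) (Des la (promotion la T) 1).
  by rewrite /Des_e -en.
rewrite !arr; apply: circular_flip; rewrite ?size_map ?size_iota //; first by rewrite nm.
move=> a; apply: nth_circular_flip; first by rewrite nm.
  move=> i ni; rewrite (Des_word pvD uv mE) ?sv // (Des_word pD uw mS) ?sw; last lia.
  by rewrite desc_evac // ?sw; [congr desc; lia|lia|lia].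
by rewrite (Des1 E v) // (Des1 S w) // desc_promotion_evac // sw.
Qed.
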